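(* Let $G$ be an undirected graph and $s\in V(G)$. Then $$\nu(s,s;G)=\min\Biggl\{\,|E(S)\setminus F|+\sum_{C\in\mathrm{comp}(G-S)}\Bigl\lfloor\frac{|E(S,C)|}{2}\Bigr\rfloor\;:\; s\in S,\ (S,F)\text{ is a bipartite subgraph of }G\Biggr\},$$ where the minimum ranges over all $S\subseteq V(G)$ with $s\in S$ and $F\subseteq E(S)$ such that the graph $(S,F)$ is bipartite.
   Context: Graphs may have parallel edges. A $(p,q)$-trail is a sequence $(x_0,e_1,x_1,\dots,e_r,x_r)$ with $x_0=p$, $x_r=q$, each $e_i$ an edge with ends $x_{i-1},x_i$, and the $e_i$ pairwise distinct; it is odd if $r$ is odd. $\nu(s,s;G)$ is the maximum number of pairwise edge-disjoint odd $(s,s)$-trails in $G$. $E(S)$ denotes the set of edges with both ends in $S$; for disjoint vertex sets $S,C$, $E(S,C)$ denotes the set of edges with one end in $S$ and the other in $C$; $\mathrm{comp}(G-S)$ denotes the set of connected components of $G-S$ (each identified with its vertex set). *)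

(* Defs.v *)
From mathcomp Require Import all_boot.

Set Implicit Arguments.
Unset Strict Implicit.
Unset Printing Implicit Defensive.

(* Finite undirected multigraphs.  The ends of an edge form a set of vertices:
   two vertices for an ordinary edge, one for a loop.  Distinct elements of
   [edge] may have the same ends.  Thus "e has ends x and y" is
   [ends e == [set x; y]], where x = y is allowed. *)
Record mgraph := MGraph {
  vert : finType;
  edge : finType;
  ends : edge -> {set vert};
  ends_card : forall e, 0 < #|ends e| <= 2
}.

Section Multigraph.
Variable G : mgraph.
Implicit Types (p q x y s : vert G) (S A B C : {set vert G}).
Implicit Types (F : {set edge G}) (t : seq (edge G * vert G)).

(* The trail (x_0, e_1, x_1, ..., e_r, x_r) is represented by its initial
   vertex x_0 together with the sequence t = [:: (e_1, x_1); ...; (e_r, x_r)],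
   so that r = size t. *)
Fixpoint walk x t : bool :=
  if t is (e, y) :: t' then (ends e == [set x; y]) && walk y t' else true.

Definition trail_edges t : seq (edge G) := unzip1 t.

Definition trail p q t : bool :=
  [&& walk p t, last p (unzip2 t) == q & uniq (trail_edges t)].

Definition odd_trail p q t : bool := trail p q t && odd (size t).

Lemma trail_size p q t : trail p q t -> size t <= #|edge G|.
Proof.
case/and3P=> _ _ /card_uniqP; rewrite size_map => <-; exact: max_card.
Qed.

Definition edge_disjoint t1 t2 : bool :=
  ~~ has (mem (trail_edges t1)) (trail_edges t2).

(* By [trail_size], the length bound in the type of trails is no restriction;
   it only makes the type finite. *)
Definition odd_packing p q (P : {set #|edge G|.-bseq (edge G * vert G)}) : bool :=
  [forall t in P, odd_trail p q t] &&
  [forall t1 in P, forall t2 in P, (t1 != t2) ==> edge_disjoint t1 t2].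

Definition nu p q : nat :=
  \max_(P : {set #|edge G|.-bseq (edge G * vert G)} | odd_packing p q P) #|P|.

Definition edges_in S : {set edge G} := [set e | ends e \subset S].

Definition edges_between A B : {set edge G} :=
  [set e | [exists x in A, exists y in B, ends e == [set x; y]]].

Definition adj_outside S : rel (vert G) :=
  [rel x y | [&& x \notin S, y \notin S & [exists e, ends e == [set x; y]]]].

Definition comp_minus S : {set {set vert G}} :=
  equivalence_partition (connect (adj_outside S)) (~: S).

Definition bipartite_subgraph S F : bool :=
  (F \subset edges_in S) &&
  [exists A : {set vert G}, (A \subset S) && (F \subset edges_between A (S :\: A))].

Definition bound S F : nat :=
  #|edges_in S :\: F| + \sum_(C in comp_minus S) (#|edges_between S C| %/ 2).

End Multigraph.

(* Main.v *)
Require Import Defs.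
From mathcomp Require Import all_boot zify.

Set Implicit Arguments.
Unset Strict Implicit.
Unset Printing Implicit Defensive.

(* An odd closed trail at s either uses an edge of E(S) \ F, or leaves S and so
   uses two edges of E(S, C) for some component C; this gives "<=".

   For ">=", packing odd trails is reduced to matching in an auxiliary graph H.
   Each end of each edge of G is a half-edge, taken with a sign + and with a
   sign -, the negative half-edges at s being discarded.  In H, a half-edge is
   joined to the half-edge of the same sign at the other end of its edge, and
   half-edges of opposite signs at the same vertex are joined.  Let M be a
   matching of H and M0 the matching that pairs the two signs of every half-edge
   not at s.  A path of M + M0 joining two half-edges at s traverses an odd number of
   edges of G, each at most once, and distinct paths use distinct edges.  So
   d(s) <= 2 nu + (number of vertices of H missed by M).

   The Tutte-Berge formula provides M together with a set U of removed vertices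
   such that the number of missed vertices is at most odd(H - U) - |U|.  If U
   is smallest, each of its vertices has neighbours in at least three components
   of H - U, because otherwise it could be put back.  A half-edge has only one
   neighbour at another vertex, so it follows that, at every vertex, U contains
   all half-edges of one sign or none at all.  The vertices where it contains
   some, together with s, form S, and the signs give the bipartition defining F. *)

(** * The Tutte-Berge formula *)

Section Involutions.
Variables (T : finType) (g : T -> T).

(** Each orbit {x, g x} has exactly one element that precedes its image in the enumeration, so
    comparing ranks selects one representative per pair. *)
Lemma card_involution_half (S : {set T}) :
  {in S, forall x, [/\ g x \in S, g (g x) = x & g x != x]} ->
  #|S| = (#|[set x in S | enum_rank x < enum_rank (g x)]|).*2.
Proof.
move=> gS; set R := [set x in S | _].
have -> : S = R :|: [set g x | x in R].
  apply/setP=> x; rewrite !inE; apply/idP/orP=> [xS|[/andP[]//|]].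
    case: (gS x xS) => gxS ggx ngx; rewrite xS /=.
    case: (ltngtP (enum_rank x) (enum_rank (g x))) => [||/ord_inj/enum_rank_inj eqx].
    - by left.
    - by move=> lt; right; apply/imsetP; exists (g x); rewrite ?inE ?gxS ?ggx.
    - by rewrite -eqx eqxx in ngx.
  by case/imsetP=> y; rewrite inE => /andP[/gS[] ? ? ? _] ->.
have dis : R :&: [set g x | x in R] = set0.
  apply/setP=> x; rewrite !inE; apply/negP=> /andP[/andP[xS lt1] /imsetP[y]].
  rewrite inE => /andP[/gS[_ ggy _] lt2] eqx; move: lt1.
  by rewrite eqx ggy ltnNge ltnW.
rewrite cardsU dis cards0 subn0 card_in_imset ?addnn // => x y.
rewrite !inE => /andP[/gS[_ gx _] _] /andP[/gS[_ gy _] _] eqg.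
by rewrite -gx eqg gy.
Qed.

End Involutions.

Section Matchings.
Variables (T : finType) (e : rel T).
Hypothesis e_sym : symmetric e.
Implicit Types (x y z t : T) (Z : {set T}) (m n : {ffun T -> T}).

(* A matching avoiding Z is encoded as the involution exchanging the two ends
   of each of its edges and fixing all other vertices. *)
Definition matching Z m : bool :=
  [forall x, (m (m x) == x) && ((m x != x) ==> (x \notin Z) && e x (m x))].

Definition missed Z m : {set T} := [set x | (x \notin Z) && (m x == x)].

Definition max_matching Z m : bool :=
  matching Z m &&
  [forall n, matching Z n ==> (#|missed Z m| <= #|missed Z n|)].

Lemma matchingP Z m :
  reflect (involutive m /\ forall x, m x != x -> x \notin Z /\ e x (m x))
          (matching Z m).
Proof.
apply: (iffP forallP) => [H|[H1 H2] x].
  split=> x; first by case/andP: (H x) => /eqP.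
  by case/andP: (H x) => _ /implyP h /h /andP.
by rewrite H1 eqxx; apply/implyP=> /H2[-> ->].
Qed.

Lemma max_matchingP Z m :
  reflect (matching Z m /\ forall n, matching Z n -> #|missed Z m| <= #|missed Z n|)
          (max_matching Z m).
Proof.
apply: (iffP andP) => [[H1 /forallP H2]|[H1 H2]]; split=> //.
  by move=> n; exact/implyP.
by apply/forallP=> n; apply/implyP; exact: H2.
Qed.

Lemma max_matching_exists Z : exists m, max_matching Z m.
Proof.
have id_m : matching Z [ffun x => x].
  by apply/matchingP; split=> x; rewrite !ffunE // eqxx.
case: (arg_minnP (fun m => #|missed Z m|) id_m) => m mm min.
by exists m; apply/max_matchingP.
Qed.

Lemma card_missed_odd Z m : matching Z m -> odd #|missed Z m| = odd #|~: Z|.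
Proof.
case/matchingP=> invm em.
rewrite -(cardsID (missed Z m) (~: Z)) oddD.
have -> : ~: Z :&: missed Z m = missed Z m.
  by apply/setIidPr/subsetP=> x; rewrite !inE => /andP[].
rewrite (@card_involution_half _ m (_ :\: _)) ?odd_double ?addbF // => x.
rewrite !inE => /andP[+ xZ]; rewrite xZ /= => nx; split=> //.
have nmx : m (m x) != m x by rewrite invm eq_sym.
by case: (em _ nmx) => -> _; rewrite nmx.
Qed.

(** The edge xy is inserted and the former mates of x and y are freed. If both ends were missed,
    this augments [m]; if only one was, it is the exchange in Gallai's lemma. *)
Definition link m x y : {ffun T -> T} :=
  [ffun w => if w == x then y else if w == y then x else
             if (m w == x) || (m w == y) then w else m w].

Lemma link_matching Z m x y : matching Z m ->
  x \notin Z -> y \notin Z -> x != y -> e x y -> matching Z (link m x y).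
Proof.
case/matchingP=> invm em xZ yZ xy exy; apply/matchingP; split=> w; rewrite !ffunE.
  case: (eqVneq w x) => [->|wx]; first by rewrite eqxx eq_sym (negPf xy).
  case: (eqVneq w y) => [->|wy]; first by rewrite eqxx.
  case h: ((m w == x) || (m w == y)); first by rewrite (negPf wx) (negPf wy) h.
  case/norP: (negbT h) => /negPf mx /negPf my.
  by rewrite mx my invm (negPf wx) (negPf wy).
case: (eqVneq w x) => [-> _|wx]; first by [].
case: (eqVneq w y) => [-> _|wy]; first by rewrite e_sym.
by case: ifP; rewrite ?eqxx // => _ /em.
Qed.

Lemma max_matching_missed_adj Z m x y : max_matching Z m ->
  x \in missed Z m -> y \in missed Z m -> x != y -> ~~ e x y.
Proof.
case/max_matchingP=> mm max; rewrite !inE => /andP[xZ /eqP mx] /andP[yZ /eqP my] xy.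
apply/negP=> exy; have := max _ (link_matching mm xZ yZ xy exy).
have [invm _] := matchingP _ _ mm.
rewrite leqNgt => /negP; apply; apply: proper_card; apply/properP; split.
  apply/subsetP=> w; rewrite !inE !ffunE => /andP[->] /=.
  case: (eqVneq w x) => [->|wx]; first by rewrite eq_sym (negPf xy).
  case: (eqVneq w y) => [->|wy]; first by rewrite (negPf xy).
  case: ifP => // /orP[] /eqP mw _; rewrite -{1}mw in mx my; apply/eqP.
    by rewrite -(invm w) mw -{2}mw invm -[RHS]invm mx.
  by rewrite -(invm w) mw -{2}mw invm -[RHS]invm my.
by exists x; rewrite !inE ?xZ ?mx ?eqxx // ffunE eqxx eq_sym (negPf xy).
Qed.

(** Exempting x = y makes the relation reflexive; Gallai's lemma makes it an equivalence when every
    vertex outside [Z] is missed by some maximum matching. *)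
Definition never_both_missed Z x y : bool :=
  [forall m, max_matching Z m ==>
     ~~ [&& x \in missed Z m, y \in missed Z m & x != y]].

Lemma never_both_missedP Z x y :
  reflect (forall m, max_matching Z m -> x \in missed Z m -> y \in missed Z m -> x = y)
          (never_both_missed Z x y).
Proof.
apply: (iffP forallP) => [H m mm xm ym|H m].
  by have := H m; rewrite mm xm ym /= negbK => /eqP.
apply/implyP=> mm; apply/negP=> /and3P[xm ym]; apply/negP; rewrite negbK.
by rewrite (H m).
Qed.

(* Gallai's lemma: a matching n missing t, chosen with largest agreement with a
   matching m missing u and v, could be switched to agree with m more. *)
Lemma never_both_missed_trans Z t u v :
  (exists2 n, max_matching Z n & t \in missed Z n) ->
  never_both_missed Z u t -> never_both_missed Z t v -> never_both_missed Z u v.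
Proof.
case=> n0 maxn0 tn0 /never_both_missedP ut /never_both_missedP tv.
apply/never_both_missedP => m maxm um vm; apply/eqP/negPn/negP=> uv.
have tNm : t \notin missed Z m.
  apply/negP=> tm; move: uv; rewrite (ut _ maxm um tm) (tv _ maxm tm vm).
  by rewrite eqxx.
pose P n := max_matching Z n && (t \in missed Z n).
have P0 : P n0 by rewrite /P maxn0.
case: (arg_maxnP (fun n : {ffun T -> T} => #|[set x | (m x == n x) && (m x != x)]|) P0).
move=> {n0 maxn0 tn0 P0} n /andP[maxn tn] best.
have [/matchingP[invm em] minm] := max_matchingP _ _ maxm.
have [mn minn] := max_matchingP _ _ maxn; have [invn en] := matchingP _ _ mn.
have eqc : #|missed Z m| = #|missed Z n|.
  by apply/eqP; rewrite eqn_leq minm ?minn //; case/max_matchingP: maxm.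
have uNn : u \notin missed Z n.
  by apply/negP=> un; move/negP: tNm; apply; rewrite -(ut n maxn un tn).
have vNn : v \notin missed Z n.
  by apply/negP=> vn; move/negP: tNm; apply; rewrite (tv n maxn tn vn).
(* [u] and [v] are missed by [m] only. The missed sets have equal size, so [n] alone misses some [x]
   besides [t]. *)
have: 1 < #|missed Z n :\: missed Z m|.
  have := cardsID (missed Z m) (missed Z n).
  rewrite -eqc -(cardsID (missed Z n) (missed Z m)) setIC => /addnI ->.
  have : [set u; v] \subset missed Z m :\: missed Z n.
    by apply/subsetP=> w; rewrite in_set2 => /orP[] /eqP->; rewrite in_setD ?uNn ?vNn.
  by move/subset_leq_card; rewrite cards2 uv.
rewrite (cardsD1 t) in_setD tNm tn ltnS => /card_gt0P[x].
rewrite !inE => /and3P[xt xm /andP[xZ /eqP nx]]; rewrite xZ /= in xm.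
set y := m x; have [_ exy] := em _ xm.
have myx : m y = x by rewrite invm.
have yZ : y \notin Z by case: (em y) => //; rewrite myx eq_sym.
have ny : n y != y.
  apply/negP=> nyy; have : ~~ e x y.
    apply: (max_matching_missed_adj maxn); rewrite ?inE ?xZ ?yZ ?nx ?eqxx //.
    by rewrite eq_sym.
  by rewrite exy.
have xy : x != y by rewrite eq_sym.
(* Replacing the edge from [y] to [n y] by xy trades the missed vertex [x] for [n y]: [n'] stays
   maximum, still misses [t], and now agrees with [m] at [x]. *)
have mn' := link_matching mn xZ yZ xy exy; set n' := link n x y in mn'.
have n'E w : n' w = if w == x then y else if w == y then x else
             if w == n y then w else n w.
  rewrite ffunE; case: eqVneq => // wx; case: eqVneq => // wy.
  have -> : (n w == x) = false.
    by apply/negP=> /eqP nw; rewrite -(invn w) nw nx eqxx in wx.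
  by rewrite /= -(can_eq invn) invn.
have miss' : missed Z n' \subset n y |: (missed Z n :\ x).
  apply/subsetP=> w; rewrite !inE n'E => /andP[wZ]; rewrite wZ.
  case: (eqVneq w x) => [->|wx]; first by rewrite eq_sym (negPf xy).
  case: (eqVneq w y) => [->|wy]; first by rewrite (negPf xy).
  by case: (eqVneq w (n y)).
have tmiss : t \in missed Z n'.
  move: tn; rewrite !inE n'E => /andP[-> /eqP nt] /=.
  rewrite [t == x]eq_sym (negPf xt); case: (eqVneq t y) => [ty|_]; first by rewrite -ty nt eqxx in ny.
  by case: ifP; rewrite ?nt.
have maxn' : max_matching Z n'.
  apply/max_matchingP; split=> // k /minn; apply: leq_trans.
  apply: leq_trans (subset_leq_card miss') _.
  rewrite cardsU1 (cardsD1 x (missed Z n)) !inE xZ nx eqxx /= leq_add2r.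
  exact: leq_b1.
have := best n'; rewrite /P maxn' tmiss => /(_ isT).
rewrite /= leqNgt => /negP; apply; apply: proper_card; apply/properP; split; last first.
  exists x; rewrite !inE ?n'E ?eqxx /= ?xm //.
  by rewrite nx (negPf xm).
(* No agreement is lost, because the dropped edge is not in [m], where the mate of [y] is [x]. *)
apply/subsetP=> w; rewrite !inE n'E => /andP[/eqP mnw ->]; rewrite andbT mnw.
case: (eqVneq w x) => [wx|wx]; first by rewrite -mnw wx.
case: (eqVneq w y) => [wy|wy]; first by rewrite -mnw wy myx.
case: (eqVneq w (n y)) => // wny.
by move: wx; rewrite -myx wny -[n y]invm -wny mnw wny invn eqxx.
Qed.

(** Labels stand in for the components of the graph minus [Z]: under a separating labelling every
    class is a union of components, so an odd class contains an odd component. *)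
Definition label_class Z (c : {ffun T -> T}) l : {set T} :=
  [set x | (x \notin Z) && (c x == l)].

Definition odd_labels Z c : {set T} := [set l | odd #|label_class Z c l|].

Definition separates Z (c : {ffun T -> T}) : Prop :=
  forall x y, x \notin Z -> y \notin Z -> e x y -> c x = c y.

(** The labels are the classes of [never_both_missed]. Adjacent vertices are never both missed, so
    edges stay within a class; in the class of a missed vertex, [m] pairs off all the others. *)
Lemma critical_labelling Z m :
  (forall t, t \notin Z -> exists2 n, max_matching Z n & t \in missed Z n) ->
  max_matching Z m ->
  exists2 c, separates Z c & #|missed Z m| <= #|odd_labels Z c|.
Proof.
move=> crit maxm; have [mm _] := max_matchingP _ _ maxm.
have [invm em] := matchingP _ _ mm.
have refl x : never_both_missed Z x x by exact/never_both_missedP.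
have sym x y : never_both_missed Z x y -> never_both_missed Z y x.
  by move/never_both_missedP=> xy; apply/never_both_missedP=> n mn ym xm; rewrite (xy n).
have trans t u v : t \notin Z -> never_both_missed Z u t ->
    never_both_missed Z t v -> never_both_missed Z u v.
  by move=> /crit; apply: never_both_missed_trans.
(* [pick] depends only on the set of candidates, so equivalent vertices get the same representative.
   Outside [Z] the default is not reached, as [x] is itself a candidate. *)
pose c := [ffun x => odflt x [pick y | (y \notin Z) && never_both_missed Z x y]].
have cP x : x \notin Z -> c x \notin Z /\ never_both_missed Z x (c x).
  move=> xZ; rewrite ffunE; case: pickP => [y /andP[] //|/(_ x)].
  by rewrite xZ refl.
have cE x y : x \notin Z -> y \notin Z -> (c x == c y) = never_both_missed Z x y.
  move=> xZ yZ; apply/eqP/idP=> [eqc|xy].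
    have [_ nx] := cP _ xZ; have [cyZ ny] := cP _ yZ.
    by apply: (trans (c y)) => //; [rewrite -eqc|apply: sym].
  rewrite !ffunE (eq_pick (Q := fun z => (z \notin Z) && never_both_missed Z y z)).
    by case: pickP => [//|/(_ y)]; rewrite yZ refl.
  move=> z; case zZ: (z \in Z) => //=; apply/idP/idP; first exact/trans/sym.
  exact: trans.
exists c => [x y xZ yZ exy|].
  apply/eqP; rewrite cE //; apply/never_both_missedP=> n maxn xn yn.
  apply/eqP/negPn/negP=> xy.
  by have := max_matching_missed_adj maxn xn yn xy; rewrite exy.
have inj : {in missed Z m &, injective c}.
  move=> x y xm ym /eqP; rewrite cE; first by move/never_both_missedP/(_ m maxm xm ym).
    by case/setIdP: xm.
  by case/setIdP: ym.
rewrite -(card_in_imset inj); apply/subset_leq_card/subsetP=> _ /imsetP[x xm ->].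
have /andP[xZ /eqP mx] : (x \notin Z) && (m x == x) by rewrite inE in xm.
have xx : x \in label_class Z c (c x) by rewrite inE xZ eqxx.
rewrite inE (cardsD1 x) xx oddD /=; apply/negbT.
rewrite (@card_involution_half _ m) ?odd_double // => y.
rewrite !inE => /and3P[yx yZ cy]; rewrite invm.
have my : m y != y.
  apply: contra yx => my; apply/eqP/inj => //; last exact/eqP.
  by rewrite inE yZ.
have [_ eym] := em _ my.
have myZ : m y \notin Z by case: (em (m y)) => //; rewrite invm eq_sym.
split=> //; rewrite myZ -(eqP cy) cE //=; apply/andP; split.
  by apply: contra my => /eqP myx; rewrite -[y in _ == y]invm myx mx.
apply/never_both_missedP=> n maxn ym' yn.
by have := max_matching_missed_adj maxn yn ym'; rewrite eq_sym eym => /(_ my).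
Qed.

(** Induction on the number of vertices outside [Z]. If each is missed by some maximum matching,
    [critical_labelling] applies; otherwise some [t] is always covered, and it is moved into [Z]. *)
Lemma tutte_berge Z : exists m Z' c,
  [/\ matching Z m, Z \subset Z', separates Z' c
    & #|missed Z m| + #|Z' :\: Z| <= #|odd_labels Z' c|].
Proof.
have [k] := ubnP #|~: Z|; elim: k Z => // k IH Z; rewrite ltnS => Zk.
have [M maxM] := max_matching_exists Z.
have [crit|] := boolP [forall t, (t \notin Z) ==>
    [exists n, max_matching Z n && (t \in missed Z n)]].
  have [|c sepc lec] := @critical_labelling Z M _ maxM.
    by move=> t tZ; move/forallP/(_ t): crit; rewrite tZ => /existsP[n /andP[]]; exists n.
  exists M, Z, c; rewrite setDv cards0 addn0; split=> //.
  by case/max_matchingP: maxM.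
case/forallPn=> t; rewrite negb_imply => /andP[tZ /existsPn tcov].
have [|m [Z' [c [mm ZZ' sepc lec]]]] := IH (t |: Z).
  apply: leq_trans Zk; rewrite [X in _ < X](cardsD1 t) inE tZ add1n ltnS.
  by apply/subset_leq_card/subsetP=> x; rewrite !inE negb_or.
have [invm em] := matchingP _ _ mm.
have mmZ : matching Z m.
  by apply/matchingP; split=> // x /em[]; rewrite !inE negb_or => /andP[].
have mt : m t = t.
  by apply/eqP; apply: contraT => /em[]; rewrite !inE eqxx.
have missE : missed Z m = t |: missed (t |: Z) m.
  apply/setP=> x; rewrite !inE negb_or.
  by case: (eqVneq x t) => [->|] //=; rewrite tZ mt eqxx.
have miss1 : #|missed Z m| = #|missed (t |: Z) m|.+1.
  by rewrite missE cardsU1 !inE eqxx.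
have [mM minM] := max_matchingP _ _ maxM.
have ltM : #|missed Z M| < #|missed Z m|.
  rewrite ltnNge; apply/negP=> le.
  have maxm : max_matching Z m.
    by apply/max_matchingP; split=> // n /minM; apply: leq_trans.
  by have := tcov m; rewrite maxm missE setU11.
exists M, Z', c; split=> //; first by apply: subset_trans ZZ'; apply: subsetU1.
apply: leq_trans lec.
have -> : #|Z' :\: Z| = #|Z' :\: (t |: Z)|.+1.
  rewrite (cardsD1 t) inE tZ (subsetP ZZ') ?setU11 // add1n; congr (#|pred_of_set _|.+1).
  by rewrite setDDl setUC.
rewrite addnS -addSn leq_add2r -ltnS -miss1 ltn_neqAle.

rewrite ltM andbT.
(* As [m] misses [t], it is not maximum, and by parity it misses at least two more vertices than
   [M]: one pays for [t] missed by [m], one for [t] in [Z']. *)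
apply/eqP=> /(congr1 odd); rewrite /= (card_missed_odd mM) (card_missed_odd mmZ).
by case: (odd _).
Qed.

(** Putting [u] back fuses it with the classes [l1] and [l2]. If these are distinct and both odd,
    the extra vertex [u] keeps the fused class odd, so at most one odd label is lost. *)
Lemma label_merge Z c u l1 l2 : u \in Z -> separates Z c ->
  (forall z, z \notin Z -> e u z -> c z \in [:: l1; l2]) ->
  exists2 c', separates (Z :\ u) c' &
    #|odd_labels Z c| <= #|odd_labels (Z :\ u) c'|.+1.
Proof.
move=> uZ sepc nbu; pose c' := [ffun z => if (z == u) || (c z == l2) then l1 else c z].
have nbu' z : z != u -> z \notin Z -> e u z -> c' z = l1.
  move=> zu zZ /nbu; rewrite ffunE (negPf zu) !inE /= => /(_ zZ).
  by case: (c z == l2) => //=; rewrite orbF => /eqP.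
exists c'.
  move=> x y; rewrite !inE !negb_and !negbK.
  have c'u : c' u = l1 by rewrite ffunE eqxx.
  case: (eqVneq x u) => [->|xu] /= xZ; case: (eqVneq y u) => [->|yu] //= yZ exy.
  - by rewrite c'u nbu'.
  - by rewrite c'u nbu' // e_sym.
  - by rewrite !ffunE (negPf xu) (negPf yu) (sepc x y).
have other l : l != l1 -> l != l2 -> label_class (Z :\ u) c' l = label_class Z c l.
  move=> nl1 nl2; apply/setP=> x; rewrite !inE ffunE negb_and negbK.
  case: eqVneq => [->|xu] /=; first by rewrite eq_sym (negPf nl1) uZ.
  by case: (eqVneq (c x) l2) => [->|//]; rewrite eq_sym (negPf nl1) eq_sym (negPf nl2).
have odd1 : odd #|label_class (Z :\ u) c' l1| =
    ~~ (odd #|label_class Z c l1| (+) (l1 != l2) && odd #|label_class Z c l2|).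
  have -> : label_class (Z :\ u) c' l1 = u |: (label_class Z c l1 :|: label_class Z c l2).
    apply/setP=> x; rewrite !inE ffunE negb_and negbK.
    case: (eqVneq x u) => [->|xu] /=; first by rewrite eqxx.
    by rewrite -andb_orr; congr (_ && _); case: (c x == l2); rewrite ?eqxx ?orbT ?orbF.
  rewrite cardsU1 !inE uZ /=; congr (~~ _).
  case: (eqVneq l1 l2) => [->|l12]; first by rewrite setUid addbF.
  rewrite cardsU (_ : _ :&: _ = set0) ?cards0 ?subn0 ?oddD //.
  by apply/setP=> x; rewrite !inE; case: (eqVneq (c x) l1) => [->|]; rewrite ?andbF // (negPf l12) !andbF.
have [a /subset_leq_card] : exists a, odd_labels Z c \subset a |: odd_labels (Z :\ u) c'.
  have mem_other l : l != l1 -> l != l2 -> l \in odd_labels Z c -> l \in odd_labels (Z :\ u) c'.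
    by move=> nl1 nl2; rewrite !inE other.
  case O': (l1 \in odd_labels (Z :\ u) c').
    exists l2; apply/subsetP=> l odd_l; rewrite in_setU1; have [//|nl2] := eqVneq l l2.
    by have [->|nl1] := eqVneq l l1; [rewrite O'|exact: mem_other].
  move: O'; rewrite inE odd1 => /negbFE O'.
  case O1: (l1 \in odd_labels Z c).
    exists l1; apply/subsetP=> l odd_l; rewrite in_setU1; have [//|nl1] := eqVneq l l1.
    have [eq2|nl2] := eqVneq l l2; last exact: mem_other.
    have l12 : l1 != l2 by rewrite -eq2 eq_sym.
    by move: O1 O' odd_l; rewrite eq2 !inE l12 => -> + o2; rewrite o2.
  exists l2; apply/subsetP=> l odd_l; rewrite in_setU1; have [//|nl2] := eqVneq l l2.
  by have [eq1|nl1] := eqVneq l l1; [rewrite -eq1 odd_l in O1|exact: mem_other].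
move=> le; apply: leq_trans le _; rewrite cardsU1 -add1n leq_add2r; exact: leq_b1.
Qed.

(** Vertices are put back as long as [label_merge] applies: at most one odd label is lost while
    [#|Z :\: Z0|] drops by one, so the inequality survives. *)
Lemma tutte_berge_minimal Z0 : exists m Z c,
  [/\ matching Z0 m, Z0 \subset Z, separates Z c,
      #|missed Z0 m| + #|Z :\: Z0| <= #|odd_labels Z c|
    & forall u l1 l2, u \in Z -> u \notin Z0 ->
        exists z, [/\ z \notin Z, e u z & c z \notin [:: l1; l2]]].
Proof.
have [m [Z [c [mm]]]] := tutte_berge Z0.
have [k] := ubnP #|Z|; elim: k Z c => // k IH Z c Zk Z0Z sepc lec.
have [/existsP[u /existsP[l1 /existsP[l2 /and3P[uZ uZ0 /forallP nbu]]]]|min] :=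
  boolP [exists u, exists l1, exists l2, [&& u \in Z, u \notin Z0 &
    [forall z, [&& z \notin Z & e u z] ==> (c z \in [:: l1; l2])]]].
  have [|c' sepc' lec'] := @label_merge Z c u l1 l2 uZ sepc.
    by move=> z zZ uz; have := nbu z; rewrite zZ uz.
  apply: (IH (Z :\ u) c') => //.
  - by move: Zk; rewrite (cardsD1 u) uZ.
  - by rewrite subsetD1 Z0Z.
  rewrite -ltnS; apply: leq_trans lec'; apply: leq_trans lec.
  rewrite -addnS leq_add2l (cardsD1 u (Z :\: Z0)) inE uZ uZ0 add1n ltnS.
  by apply/subset_leq_card/subsetP=> x; rewrite !inE => /and3P[-> -> ->].
exists m, Z, c; split=> // u l1 l2 uZ uZ0; 
have [z /and3P[]|none] := pickP [pred z | [&& z \notin Z, e u z & c z \notin [:: l1; l2]]].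
  by exists z.
case/negP: min; apply/existsP; exists u; apply/existsP; exists l1; apply/existsP; exists l2.
rewrite uZ uZ0; apply/forallP=> z; apply/implyP=> /andP[zZ uz].
by move: (none z); rewrite /= zZ uz => /negbFE.
Qed.

End Matchings.

(** * From matchings to trails *)

Section TwoInvolutions.
Variables (T : finType) (a m : T -> T).
Hypotheses (aK : involutive a) (mK : involutive m).

(** From a fixed point x of [a], the orbit visits every second vertex of the path of x in the union
    of the two matchings, then the others on the way back. Its order n is thus the number of
    vertices of the path, and [iter n./2 f x] is the other end, fixed by [a] for n even and by [m]
    for n odd. *)
Definition alternate x := a (m x).

Lemma alternate_inj : injective alternate.
Proof. exact: inj_comp (can_inj aK) (can_inj mK). Qed.

Variable x : T.
Hypothesis ax : a x = x.
Notation f := alternate.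
Notation n := (order f x).

(** Conjugation by [a] inverts [f], so [a] reverses the orbit of its fixed point. *)
Lemma alternate_reflect1 i : i <= n -> a (iter i f x) = iter (n - i) f x.
Proof.
elim: i => [|i IH] lei; first by rewrite subn0 (iter_order alternate_inj).
by apply: alternate_inj; rewrite -iterS -subSn // subSS -IH ?(ltnW lei) // /f /= aK mK.
Qed.

Lemma alternate_reflect2 i : i < n -> m (iter i f x) = iter (n - i.+1) f x.
Proof. by move=> lei; rewrite -alternate_reflect1 //= aK. Qed.

Lemma iter_alternate_inj i j : i < n -> j < n -> iter i f x = iter j f x -> i = j.
Proof. by move=> ltin ltjn eqij; rewrite -(findex_iter ltin) eqij findex_iter. Qed.

Lemma alternate_fixed y : a y = y -> fconnect f x y ->
  y = x \/ ~~ odd n /\ y = iter n./2 f x.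
Proof.
move=> ay xy; move: (iter_findex xy) (findex_max xy) => yE; set i := findex f x y in yE *.
move=> ltin; case: (posnP i) => [i0|i_gt0]; first by left; rewrite -yE i0.
right; have := alternate_reflect1 (ltnW ltin); rewrite yE ay -yE.
move/iter_alternate_inj=> iE.
have nE : n = i.*2 by lia.
by rewrite nE odd_double doubleK.
Qed.

Lemma connect_mate y : fconnect f x y -> fconnect f x (m y).
Proof.
move=> xy; rewrite -(iter_findex xy) alternate_reflect2 ?findex_max //.
exact: fconnect_iter.
Qed.

Lemma order_alternate y : fconnect f x y -> order f y = n.
Proof.
move=> xy; apply/esym/eq_card.
exact: (same_connect (fconnect_sym alternate_inj)).
Qed.

Lemma half_order_lt : n./2 < n.
Proof. by have := order_gt0 f x; lia. Qed.

Lemma mate_middle_odd : odd n -> m (iter n./2 f x) = iter n./2 f x.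
Proof.
move=> oddn; rewrite alternate_reflect2 ?half_order_lt //; congr iter.
by lia.
Qed.

Section Even.
Hypothesis evenn : ~~ odd n.

Let nE : n = n./2.*2.
Proof. by rewrite -{1}(odd_double_half n) (negPf evenn). Qed.

Lemma half_order_gt0 : 0 < n./2.
Proof. by rewrite -double_gt0 -nE order_gt0. Qed.

Lemma middle_even_fixed : a (iter n./2 f x) = iter n./2 f x.
Proof. by rewrite alternate_reflect1 ?(ltnW half_order_lt) // {1}nE -addnn addnK. Qed.

Lemma middle_even_neq : iter n./2 f x != x.
Proof.
apply/eqP=> /(@iter_alternate_inj _ 0 half_order_lt (order_gt0 _ _)) n0.
by have := half_order_gt0; rewrite n0.
Qed.

Lemma middle_evenK : iter n./2 f (iter n./2 f x) = x.
Proof. by rewrite -iterD addnn -nE (iter_order alternate_inj). Qed.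

Lemma mate_even_neq y : fconnect f x y -> m y != y.
Proof.
move=> xy; rewrite -(iter_findex xy) alternate_reflect2 ?findex_max //.
have ltin := findex_max xy; set i := findex _ _ _ in ltin *.
apply/eqP=> /iter_alternate_inj iE; move: evenn; lia.
Qed.

Lemma mate_pred_middle : m (iter n./2.-1 f x) = iter n./2 f x.
Proof.
have h := half_order_gt0.
by rewrite alternate_reflect2; [congr iter|]; lia.
Qed.

Lemma alternate_not_fixed i : 0 < i < n./2 -> a (iter i f x) != iter i f x.
Proof.
case/andP=> i_gt0 lti; have h := half_order_lt.
rewrite alternate_reflect1; last by lia.
apply/eqP=> /iter_alternate_inj; lia.
Qed.

End Even.
End TwoInvolutions.

Section NuLowerBound.
Variables (G : mgraph) (p q : vert G) (I : finType).

(** An odd trail has an edge and so is not disjoint from itself; distinct indices therefore give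
    distinct trails. By [trail_size] the default of [insub_bseq] is not reached. *)
Lemma nu_ge (R : {set I}) (t : I -> seq (edge G * vert G)) :
  (forall x, x \in R -> odd_trail p q (t x)) ->
  (forall x y, x \in R -> y \in R -> x != y -> edge_disjoint (t x) (t y)) ->
  #|R| <= nu p q.
Proof.
move=> odd_t disj_t.
pose b x : #|edge G|.-bseq (edge G * vert G) := insub_bseq _ (t x).
have bE x : x \in R -> b x = t x :> seq _.
  move=> /odd_t/andP[/trail_size sz _].
  by rewrite /b /insub_bseq insubdK.
have inj : {in R &, injective b}.
  move=> x y xR yR eqb; apply/eqP; apply: contraT => xy.
  have eqt : t x = t y by rewrite -!bE // eqb.
  have := disj_t x y xR yR xy; have := odd_t x xR; rewrite -eqt.
  case: (t x) => [|[a z] tx]; first by rewrite /odd_trail andbF.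
  by rewrite /edge_disjoint /= inE eqxx.
rewrite -(card_in_imset inj); apply: leq_bigmax_cond; apply/andP; split.
  by apply/forall_inP=> _ /imsetP[x xR ->]; rewrite bE // odd_t.
apply/forall_inP=> _ /imsetP[x xR ->]; apply/forall_inP=> _ /imsetP[y yR ->].
by apply/implyP=> bxy; rewrite !bE // disj_t //; apply: contraNneq bxy => ->.
Qed.
End NuLowerBound.

(** * Signed half-edges and the trails of a matching *)

Section SignedHalfEdges.
Variables (G : mgraph) (s : vert G) (v : edge G -> bool -> vert G).
Hypothesis vE : forall e, ends e = [set v e false; v e true].

(* ((e, b), g): the end v e b of the edge e, with sign - if g is true. *)
Definition shalf : finType := (edge G * bool * bool)%type.
Implicit Types (z w : shalf).

Definition hedge z : edge G := z.1.1.
Definition hvert z : vert G := v z.1.1 z.1.2.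
Definition opp z : shalf := (z.1.1, ~~ z.1.2, z.2).
Definition flip z : shalf := (z.1, ~~ z.2).

Definition hadj z w : bool := (w == opp z) || (hvert z == hvert w) && (z.2 != w.2).

Definition negative_at : {set shalf} := [set z | (hvert z == s) && z.2].

Lemma oppK : involutive opp.
Proof. by case=> [[e b] g]; rewrite /opp /= negbK. Qed.

Lemma flipK : involutive flip.
Proof. by case=> [h g]; rewrite /flip /= negbK. Qed.

Lemma hadj_sym : symmetric hadj.
Proof.
move=> z w; rewrite /hadj (eq_sym (hvert z)) (eq_sym z.2); congr (_ || _).
by apply/eqP/eqP=> ->; rewrite oppK.
Qed.

Lemma ends_hedge z : ends (hedge z) = [set hvert z; hvert (opp z)].
Proof. by case: z => [[e []] g]; rewrite vE //= setUC. Qed.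

Section Trails.
Variable m : {ffun shalf -> shalf}.
Hypothesis matching_m : matching hadj negative_at m.

Let mK : involutive m. Proof. by case/matchingP: matching_m. Qed.
Let m_adj z : m z != z -> z \notin negative_at /\ hadj z (m z).
Proof. by case/matchingP: matching_m => _; apply. Qed.

(** The matching M0 as an involution; its fixed points, the half-edges at [s], are possible ends of
    paths. *)
Definition flip_off z : shalf := if hvert z == s then z else flip z.

Lemma flip_offK : involutive flip_off.
Proof.
by move=> z; rewrite {2}/flip_off; case: ifP => zs; rewrite /flip_off /hvert /= zs ?flipK.
Qed.

Lemma hvert_flip_off z : hvert (flip_off z) = hvert z.
Proof. by rewrite /flip_off; case: ifP. Qed.

Lemma flip_off_fixed z : (flip_off z == z) = (hvert z == s).
Proof.
rewrite /flip_off; case: ifP; rewrite ?eqxx // => _.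
by case: z => h []; apply/negP=> /eqP[].
Qed.

Notation f := (alternate flip_off m).

Definition across z : bool := m z == opp z.

(** Only the [across] steps traverse an edge of G; all other steps of the alternating path stay at
    the same vertex. *)
Definition trail_from z k : seq (edge G * vert G) :=
  [seq (hedge w, hvert (m w)) | w <- traject f z k & across w].

Lemma hvert_mate z : ~~ across z -> hvert (m z) = hvert z.
Proof.
move=> nz; have [->//|/m_adj[_]] := eqVneq (m z) z.
by rewrite /hadj -/(across z) (negPf nz) /= => /andP[/eqP].
Qed.

Lemma trail_from_walk z k :
  walk (hvert z) (trail_from z k) &&
  (last (hvert z) (unzip2 (trail_from z k)) == hvert (iter k f z)).
Proof.
elim: k z => [|k IH] z; first by rewrite /= eqxx.
have fz : hvert (f z) = hvert (m z) by rewrite /alternate hvert_flip_off.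
rewrite iterSr /trail_from /=; case: ifP => [az|/negbT/hvert_mate az] /=.
  by rewrite ends_hedge (eqP az) eqxx -(eqP az) -fz IH.
by rewrite -az -fz IH.
Qed.

Section OneTrail.
Variable x : shalf.
Hypotheses (xs : hvert x = s) (x2 : x.2 = false) (evenx : ~~ odd (order f x)).

Let x_fixed : flip_off x = x.
Proof. by apply/eqP; rewrite flip_off_fixed xs. Qed.

Notation k := (order f x)./2.

Lemma partner_vert : hvert (iter k f x) = s.
Proof.
apply/eqP; rewrite -flip_off_fixed.
by rewrite (middle_even_fixed flip_offK mK x_fixed evenx).
Qed.

Lemma mate_trail y : fconnect f x y -> y \notin negative_at /\ hadj y (m y).
Proof. by move/(mate_even_neq flip_offK mK x_fixed evenx)/m_adj. Qed.

(** The far end of an even path is moved by [m], which moves no negative half-edge at [s]. *)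
Lemma partner_sign : (iter k f x).2 = false.
Proof.
have [] := mate_trail (fconnect_iter f k x).
by rewrite inE partner_vert eqxx /= => /negbTE.
Qed.

(** A step across an edge keeps the sign and the following flip changes it; a step within a vertex
    changes it and the flip restores it. The sign thus records the parity of the edges used, up to
    the end, where no flip occurs. *)
Lemma trail_from_parity i : i < k -> odd (size (trail_from x i)) = (iter i f x).2.
Proof.
elim: i => [|i IH] lti; first by rewrite x2.
have [_ adj] := mate_trail (fconnect_iter f i x).
have nfix : flip_off (iter i.+1 f x) != iter i.+1 f x.
  exact: (alternate_not_fixed flip_offK mK x_fixed evenx).
have hs : hvert (m (iter i f x)) != s.
  by move: nfix; rewrite flip_off_fixed /= {1}/alternate hvert_flip_off.
have sE : (iter i.+1 f x).2 = ~~ (m (iter i f x)).2.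
  by rewrite /= {1}/alternate /flip_off (negPf hs).
rewrite sE /trail_from trajectSr filter_rcons size_map.
move: adj; rewrite /hadj /= -/(across _).
case: ifP => [az _|_ /andP[_]].
  by rewrite size_rcons /= -(size_map (fun w => (hedge w, hvert (m w)))) IH ?(ltnW lti) // (eqP az).
rewrite -(size_map (fun w => (hedge w, hvert (m w)))) IH ?(ltnW lti) //.
by case: (_.2); case: (_.2).
Qed.

Lemma trail_from_odd : odd (size (trail_from x k)).
Proof.
have k_gt0 : 0 < k by exact: half_order_gt0.
have mE : m (iter k.-1 f x) = iter k f x.
  exact: (mate_pred_middle flip_offK mK x_fixed evenx).
have [] := mate_trail (fconnect_iter f k.-1 x); set y := iter k.-1 f x in mE *.
rewrite /hadj /= -/(across _) mE partner_sign => yZ adj.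
have sz : odd (size (trail_from x k.-1)) = y.2.
  by apply: trail_from_parity; rewrite prednK.
have [ay|nay] := boolP (across y).
  rewrite -(prednK k_gt0) /trail_from trajectSr filter_rcons ay size_map size_rcons /=.
  rewrite -(size_map (fun w => (hedge w, hvert (m w)))) sz.
  by have := partner_sign; rewrite -mE (eqP ay) /= => ->.
(* A last step within a vertex would start from a negative half-edge at [s], which is unmatched. *)
move: adj; rewrite -mE -/(across _) (negPf nay) /= => /andP[/eqP hy y2].
by move: yZ; rewrite inE hy mE partner_vert eqxx; case: (y.2) y2.
Qed.
End OneTrail.

(* If both copies of an edge are matched across, then they form a closed
   alternating cycle avoiding s. *)
Lemma across_same_edge x w w' : hvert x = s -> fconnect f x w ->
  across w -> across w' -> hedge w = hedge w' -> w' = w \/ w' = m w.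
Proof.
move=> xs xw aw aw' eqe.
have [->|nw] := eqVneq w' w; [by left|right].
have [//|nmw] := eqVneq w' (m w).
have nfix z : across z -> m z != z.
  by move=> /eqP->; case: z => [[e []] g]; apply/eqP=> -[].
have off z : across z -> z.2 -> hvert z != s /\ hvert (m z) != s.
  move=> az z2; split.
    by have [] := m_adj (nfix _ az); rewrite inE z2 andbT.
  have : m (m z) != m z by rewrite mK eq_sym nfix.
  by case/m_adj; rewrite inE (eqP az) /= z2 andbT.
have mw : m w = opp w by exact/eqP.
have mw' : m w' = opp w' by exact/eqP.
have w'E : w' = flip w \/ w' = flip (m w).
  move: eqe nw nmw; rewrite mw.
  case: (w) (w') => [[e b] g] [[e' b'] g']; rewrite /hedge /flip /opp /= => <-.
  case: b; case: b'; case: g; case: g'; rewrite ?eqxx // => _ _;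
    first [by left | by right].
have [ws mws] : hvert w != s /\ hvert (m w) != s.
  case w2: w.2; first exact: off.
  have w'2 : w'.2 by case: w'E => ->; rewrite ?mw /= w2.
  have [] := off w' aw' w'2; rewrite mw'.
  case: w'E => ->; rewrite mw //; rewrite /hvert /= ?negbK => h1 h2; split=> //.
have fw : f w = flip (m w) by rewrite /alternate /flip_off (negPf mws).
have mfmw : m (flip (m w)) = flip w.
  case: w'E => w'E; last by rewrite -w'E mw' w'E mw /opp /flip /= negbK; case: (w) => [[]].
  have -> : flip (m w) = m w' by rewrite mw' w'E mw.
  by rewrite mK.
(* The orbit of [w] consists of [w] and [f w], neither of them at [s], yet it contains [x]. *)
have ffw : f (f w) = w.
  by rewrite fw /alternate mfmw /flip_off /hvert /= -/(hvert w) (negPf ws) flipK.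
have wx : fconnect f w x by rewrite fconnect_sym //; apply: alternate_inj mK; exact: flip_offK.
have := iter_findex wx; move: (findex _ _ _) => i.
have : iter i f w = w \/ iter i f w = f w.
  by elim: i => [|i [] /= ->]; [left|right|left].
case=> -> xE; first by rewrite xE xs eqxx in ws.
by move: mws; rewrite -(hvert_flip_off (m w)) -/(f w) xE xs eqxx.
Qed.

Lemma trail_edgesP z k e : e \in trail_edges (trail_from z k) ->
  exists2 w, w \in traject f z k & across w /\ hedge w = e.
Proof.
rewrite /trail_edges /unzip1 -map_comp => /mapP[w]; rewrite mem_filter => /andP[aw wt] ->.
by exists w.
Qed.

Lemma traject_index x k w : k <= order f x -> w \in traject f x k ->
  fconnect f x w /\ findex f x w < k.
Proof.
move=> lek /trajectP[i lti ->]; rewrite fconnect_iter; split=> //.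
by rewrite findex_iter // (leq_trans lti).
Qed.

(** A repeated edge would be crossed at [w] and again at [m w], but [m w] lies in the half of the
    orbit that the trail does not use. *)
Lemma trail_from_uniq x : hvert x = s -> uniq (trail_edges (trail_from x (order f x)./2)).
Proof.
move=> xs; have x_fixed : flip_off x = x by apply/eqP; rewrite flip_off_fixed xs.
have lek : (order f x)./2 <= order f x by apply: ltnW; apply: half_order_lt.
rewrite /trail_edges /unzip1 -map_comp map_inj_in_uniq.
  rewrite filter_uniq // -(take_traject _ _ lek) take_uniq //; exact: orbit_uniq.
move=> w w'; rewrite !mem_filter => /andP[aw /(traject_index lek)[xw wi]].
case/andP=> aw' /(traject_index lek)[xw' w'i] eqe.
have [//|w'E] := across_same_edge xs xw aw aw' eqe.
have ltn := findex_max xw.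
have : findex f x w' = order f x - (findex f x w).+1.
  rewrite w'E -{1}(iter_findex xw).
  rewrite (alternate_reflect2 flip_offK mK x_fixed ltn) findex_iter //; lia.
lia.
Qed.

Definition starts : {set shalf} := [set x | (hvert x == s) && ~~ x.2].
Definition even_starts : {set shalf} := [set x in starts | ~~ odd (order f x)].
Definition partner x : shalf := iter (order f x)./2 f x.
(** Both ends of an even path are starts; only the one of smaller rank is kept. *)
Definition trail_starts : {set shalf} :=
  [set x in even_starts | enum_rank x < enum_rank (partner x)].

Lemma even_startsP x :
  reflect [/\ hvert x = s, x.2 = false & ~~ odd (order f x)] (x \in even_starts).
Proof.
rewrite !inE; apply: (iffP andP) => [[/andP[/eqP-> /negbTE->]]|[-> ->]] //.
by rewrite eqxx.
Qed.

Lemma starts_fixed x : hvert x = s -> flip_off x = x.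
Proof. by move=> xs; apply/eqP; rewrite flip_off_fixed xs. Qed.

Lemma partner_even_starts : {in even_starts, forall x,
  [/\ partner x \in even_starts, partner (partner x) = x & partner x != x]}.
Proof.
move=> x /even_startsP[xs x2 evenx]; have x_fixed := starts_fixed xs.
have ord : order f (partner x) = order f x.
  by apply: (order_alternate flip_offK mK); exact: fconnect_iter.
split.
- by apply/even_startsP; rewrite ord partner_vert // partner_sign.
- by rewrite {1}/partner ord (middle_evenK flip_offK mK evenx).
- exact: (middle_even_neq evenx).
Qed.

(** A common edge puts two starts in one orbit, so they are partners, and only one of two partners
    is kept. *)
Lemma card_trail_starts : #|trail_starts| <= nu s s.
Proof.
apply: (nu_ge (t := fun x => trail_from x (order f x)./2)) => [x|x y].
  case/setIdP=> /even_startsP[xs x2 evenx] _.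
  have /andP[wx lx] := trail_from_walk x (order f x)./2.
  rewrite xs in wx lx.
  rewrite /odd_trail /trail wx trail_from_uniq // trail_from_odd // (eqP lx).
  by rewrite partner_vert ?eqxx.
case/setIdP=> Ex ltx /setIdP[Ey lty] xy.
have [[xs x2 evenx] [ys y2 eveny]] := (even_startsP _ Ex, even_startsP _ Ey).
have [x_fixed y_fixed] := (starts_fixed xs, starts_fixed ys).
have lek z : (order f z)./2 <= order f z by apply: ltnW; apply: half_order_lt.
apply/hasPn=> e /trail_edgesP[w' wy [aw' ew']]; apply/negP=> /trail_edgesP[w wx [aw ew]].
have [xw _] := traject_index (lek _) wx; have [yw' _] := traject_index (lek _) wy.
have sym := fconnect_sym (alternate_inj flip_offK mK).
have xw' : fconnect f x w'.
  have [->//|->] := across_same_edge xs xw aw aw' (etrans ew (esym ew')).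
  exact: (connect_mate flip_offK mK).
have fxy : fconnect f x y by rewrite (connect_trans xw') // sym.
have [yx|[_ yE]] := alternate_fixed flip_offK mK x_fixed y_fixed fxy.
  by rewrite yx eqxx in xy.
have [_ pp _] := partner_even_starts Ex.
by move: lty; rewrite yE -/(partner x) pp ltnNge ltnW.
Qed.

(** Even paths pair their starts; an odd path leads from its start to a half-edge fixed by [m], and
    distinct starts give distinct ones. *)
Lemma card_starts : #|starts| <= (nu s s).*2 + #|missed negative_at m|.
Proof.
rewrite -(cardsID [set x | ~~ odd (order f x)] starts); apply: leq_add.
  have -> : starts :&: [set x | ~~ odd (order f x)] = even_starts.
    by apply/setP=> x; rewrite !inE.
  rewrite (card_involution_half partner_even_starts) leq_double.
  exact: card_trail_starts.
pose mid x := iter (order f x)./2 f x.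
have oddP x : x \in starts :\: [set x | ~~ odd (order f x)] ->
    [/\ hvert x = s, x.2 = false & odd (order f x)].
  by rewrite !inE negbK => /and3P[-> /eqP-> /negbTE->].
have inj : {in starts :\: [set x | ~~ odd (order f x)] &, injective mid}.
  move=> x y /oddP[xs _ oddx] /oddP[ys _ oddy] eqm.
  have xy : fconnect f x y.
    apply: connect_trans (fconnect_iter f (order f x)./2 x) _; rewrite -/(mid x) eqm.
    by rewrite (fconnect_sym (alternate_inj flip_offK mK)) fconnect_iter.
  have [//|[]] := alternate_fixed flip_offK mK (starts_fixed xs) (starts_fixed ys) xy.
  by rewrite oddx.
rewrite -(card_in_imset inj); apply/subset_leq_card/subsetP=> _ /imsetP[x /oddP[xs x2 oddx] ->].
have mmid : m (mid x) = mid x.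
  exact: (mate_middle_odd flip_offK mK (starts_fixed xs) oddx).
(* If the end of the path were negative at [s], both involutions would fix it, so it would equal
   [x], which is positive. *)
rewrite in_set mmid eqxx andbT inE; apply/negP=> /andP[mids mid2].
have fmid : f (mid x) = mid x by rewrite /alternate mmid starts_fixed ?(eqP mids).
have : fconnect f (mid x) x.
  by rewrite (fconnect_sym (alternate_inj flip_offK mK)) fconnect_iter.
move/iter_findex; move: (findex _ _ _) => i.
have -> : iter i f (mid x) = mid x by elim: i => //= i ->.
by move=> midx; rewrite midx x2 in mid2.
Qed.
End Trails.
End SignedHalfEdges.

(** * Components and weak duality *)

Lemma disjoint_family_card (I T : finType) (X : I -> {set T}) (Q : {set I})
    (Y : {set T}) k :
  {in Q &, forall i j, i != j -> [disjoint X i & X j]} ->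
  {in Q, forall i, k <= #|X i :&: Y|} -> k * #|Q| <= #|Y|.
Proof.
move=> disX leX; rewrite mulnC -sum_nat_const.
apply: (@leq_trans (\sum_(i in Q) #|X i :&: Y|)); first exact: leq_sum.
rewrite (eq_bigr (fun i => \sum_(y in Y | y \in X i) 1)); last first.
  by move=> i _; rewrite -sum1_card; apply: eq_bigl => y; rewrite inE andbC.
rewrite (exchange_big_dep (mem Y)) /=; last by move=> i y _ /andP[].
rewrite -[leqRHS]sum1_card; apply: leq_sum => y yY.
rewrite sum1_card; apply/card_le1_eqP => i j.
case/and3P=> iQ _ yi /and3P[jQ _ yj]; apply/eqP; apply: contraT => ij.
by have /disjointFr/(_ yj) := disX j i jQ iQ ij; rewrite yi.
Qed.

Lemma set2_eq (T : finType) (a b c d : T) :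
  [set a; b] = [set c; d] -> (a = c /\ b = d) \/ (a = d /\ b = c).
Proof.
move=> eqs; have : a \in [set c; d] by rewrite -eqs set21.
have : b \in [set c; d] by rewrite -eqs set22.
have : c \in [set a; b] by rewrite eqs set21.
have : d \in [set a; b] by rewrite eqs set22.
rewrite !in_set2.
by do 4!(case/orP=> /eqP ?); subst; auto.
Qed.

Lemma edges_betweenP (G : mgraph) (B C : {set vert G}) x y (e : edge G) : ends e = [set x; y] ->
  (e \in edges_between B C) = (x \in B) && (y \in C) || (y \in B) && (x \in C).
Proof.
move=> ee; rewrite inE; apply/idP/orP.
  case/exists_inP=> a aB /exists_inP[b bC]; rewrite ee => /eqP/set2_eq[] [-> ->].
    by rewrite aB bC; left.
  by rewrite aB bC; right.
case=> /andP[h1 h2]; apply/exists_inP.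
  by exists x => //; apply/exists_inP; exists y; rewrite // ee.
by exists y => //; apply/exists_inP; exists x; rewrite // ee setUC.
Qed.

Section Components.
Variables (G : mgraph) (S : {set vert G}).
Implicit Types (x y : vert G) (C : {set vert G}).

Definition comp_of x : {set vert G} := pblock (comp_minus S) x.

Lemma connect_outside_sym : connect_sym (adj_outside S).
Proof.
apply: sym_connect_sym => x y; rewrite /adj_outside /= andbCA; congr [&& _, _ & _].
by apply/eq_existsb=> e; rewrite setUC.
Qed.

Lemma connect_outside_equiv :
  {in ~: S & &, equivalence_rel (connect (adj_outside S))}.
Proof.
move=> x y z _ _ _; split=> [|xy]; first exact: connect0.
by rewrite (same_connect connect_outside_sym xy).
Qed.

Lemma comp_minus_partition : partition (comp_minus S) (~: S).
Proof. exact: equivalence_partitionP connect_outside_equiv. Qed.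

Lemma mem_comp_of x : x \notin S -> x \in comp_of x.
Proof.
by move=> xS; rewrite mem_pblock (cover_partition comp_minus_partition) inE.
Qed.

Lemma comp_of_in x : x \notin S -> comp_of x \in comp_minus S.
Proof.
by move=> xS; rewrite pblock_mem // (cover_partition comp_minus_partition) inE.
Qed.

Lemma comp_of_eq C x : C \in comp_minus S -> x \in C -> comp_of x = C.
Proof. by apply: def_pblock; case/and3P: comp_minus_partition. Qed.

Lemma comp_outside C x : C \in comp_minus S -> x \in C -> x \notin S.
Proof.
move=> CP xC; have : x \in cover (comp_minus S) by apply/bigcupP; exists C.
by rewrite (cover_partition comp_minus_partition) inE.
Qed.

Lemma comp_of_connect x y : x \notin S -> y \notin S ->
  (comp_of x == comp_of y) = connect (adj_outside S) x y.
Proof.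
move=> xS yS; rewrite eq_pblock ?(cover_partition comp_minus_partition) ?inE //.
  by rewrite (pblock_equivalence_partition connect_outside_equiv) ?inE.
by case/and3P: comp_minus_partition.
Qed.
End Components.

Section WeakDuality.
Variables (G : mgraph) (s : vert G) (S A : {set vert G}) (F : {set edge G}).
Hypotheses (sS : s \in S) (FS : F \subset edges_between A (S :\: A)).
Implicit Types t : seq (edge G * vert G).

(** Until it enters [S] the walk stays in [C], so its first edge into [S] joins [S] and [C]. *)
Lemma walk_exits_comp C x t : C \in comp_minus S -> x \in C ->
  walk x t -> last x (unzip2 t) \in S ->
  exists2 e, e \in trail_edges t & e \in edges_between S C.
Proof.
move=> CP; elim: t x => [|[e y] t IH] x xC /=.
  by move=> _ xS; have := comp_outside CP xC; rewrite xS.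
case/andP=> /eqP ee wt lS; have [yS|yS] := boolP (y \in S).
  exists e; rewrite ?mem_head // inE; apply/existsP; exists y; rewrite yS /=.
  by apply/existsP; exists x; rewrite xC ee setUC /=.
have [] := IH y _ wt lS; last by move=> f ft; exists f; rewrite // inE ft orbT.
have xS := comp_outside CP xC.
rewrite -(comp_of_eq CP xC); have /eqP-> : comp_of S x == comp_of S y.
  rewrite comp_of_connect // connect1 // /adj_outside /= xS yS.
  by apply/existsP; exists e; exact/eqP.
exact: mem_comp_of.
Qed.

(** Each edge of [F] changes sides between [A] and [S :\: A], so a walk along [F] has the parity
    dictated by its ends. Any other trail uses an edge of E(S) outside [F], or leaves [S] and
    returns by a second edge. Arbitrary ends in [S] are allowed for the induction. *)
Lemma odd_walk_uses x t : walk x t -> uniq (trail_edges t) ->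
  x \in S -> last x (unzip2 t) \in S ->
  odd (size t) != ((x \in A) (+) (last x (unzip2 t) \in A)) ->
  (exists2 e, e \in trail_edges t & e \in edges_in S :\: F) \/
  (exists2 C, C \in comp_minus S & 2 <= #|[set e in trail_edges t] :&: edges_between S C|).
Proof.
elim: t x => [|[e y] t IH] x /=; first by rewrite addbb.
case/andP=> /eqP ee wt /andP[et ut] xS lS par.
have [yS|yS] := boolP (y \in S).
  have eS : e \in edges_in S.
    by rewrite inE ee; apply/subsetP=> z; rewrite in_set2 => /orP[] /eqP->.
  have [eF|eF] := boolP (e \in F); last first.
    by left; exists e; rewrite ?mem_head // inE eS eF.
  have xyA : (x \in A) = ~~ (y \in A).
    have := subsetP FS e eF; rewrite (edges_betweenP _ _ ee) !inE xS yS !andbT.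
    by case: (x \in A); case: (y \in A).
  have [|[f ft fS]|[C CP Ct]] := IH y wt ut yS lS.
  - by move: par; rewrite xyA; case: (odd _); case: (y \in A); case: (_ \in A).
  - by left; exists f; rewrite // inE ft orbT.
  - right; exists C => //; apply: leq_trans Ct _; apply/subset_leq_card/subsetP=> f.
    by rewrite !in_setI !in_set inE => /andP[-> ->]; rewrite orbT.
right; exists (comp_of S y); first exact: comp_of_in.
have yC := mem_comp_of yS.
have [f ft fC] := walk_exits_comp (comp_of_in yS) yC wt lS.
have : [set e; f] \subset [set g in e :: trail_edges t] :&: edges_between S (comp_of S y).
  apply/subsetP=> g; rewrite in_set2 => /orP[] /eqP->; rewrite in_setI in_set inE.
    by rewrite eqxx (edges_betweenP _ _ ee) xS yC.
  by rewrite ft orbT.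
move/subset_leq_card; rewrite cards2; case: eqVneq => // eqef.
by rewrite eqef ft in et.
Qed.

Lemma nu_le_bound : nu s s <= bound S F.
Proof.
apply/bigmax_leqP=> P /andP[/forall_inP oddP /forall_inP disP].
(* The trails using at least [k] edges of [Y]; disjointness bounds their number by [#|Y|] over
   [k]. *)
pose many k Y := [set p in P | k <= #|[set e in trail_edges p] :&: Y|].
have card_many k Y : k * #|many k Y| <= #|Y|.
  apply: (@disjoint_family_card _ _ (fun p : #|edge G|.-bseq (edge G * vert G) =>
    [set e in trail_edges p])) => [p1 p2|p]; last by rewrite inE => /andP[].
  rewrite !in_set => /andP[P1 _] /andP[P2 _] p12.
  have /implyP/(_ p12)/hasPn disj := forall_inP (disP p1 P1) p2 P2.
  rewrite disjoint_subset; apply/subsetP=> e; rewrite !inE => e1.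
  by apply/negP=> /disj; rewrite /= e1.
have cover_P : P \subset many 1 (edges_in S :\: F) :|:
    \bigcup_(C in comp_minus S) many 2 (edges_between S C).
  apply/subsetP=> t Pt; rewrite in_setU; have /andP[/and3P[wt /eqP lt ut] ot] := oddP t Pt.
  have [||[e et eS]|[C CP Ct]] := odd_walk_uses wt ut sS; rewrite ?lt ?ot ?addbb //.
    apply/orP; left; rewrite inE Pt; apply/card_gt0P; exists e.
    by rewrite in_setI in_set et.
  by apply/orP; right; apply/bigcupP; exists C => //; rewrite inE Pt.
apply: leq_trans (subset_leq_card cover_P) _.
apply: leq_trans (leq_card_setU _ _) _; apply: leq_add.
  by rewrite -[X in X <= _]mul1n card_many.
apply: (big_ind2 (fun (X : {set _}) n => #|X| <= n)) => [|X1 n1 X2 n2 le1 le2|C CP].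
- by rewrite cards0.
- by apply: leq_trans (leq_card_setU _ _) _; exact: leq_add.
by rewrite leq_divRL // mulnC card_many.
Qed.
End WeakDuality.

(** * From a Tutte-Berge certificate to (S, F) *)

(** An odd class is a disjoint union of blocks, so one of them is odd, and that block determines the
    label. *)
Lemma odd_labels_refine (T : finType) (Z : {set T}) (c : {ffun T -> T})
    (B : finType) (beta : T -> B) :
  (forall x y, x \notin Z -> y \notin Z -> beta x = beta y -> c x = c y) ->
  #|odd_labels Z c| <= #|[set b | odd #|[set x | (x \notin Z) && (beta x == b)]|]|.
Proof.
move=> const; set blk := fun b => [set x | (x \notin Z) && (beta x == b)].
rewrite -(card_imset (mem (odd_labels Z c)) Some_inj).
(* The label of a block is optional because a block may be empty. *)
pose lab b := omap c [pick x in blk b].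
apply: leq_trans (leq_imset_card lab _).
apply/subset_leq_card/subsetP=> _ /imsetP[l + ->]; rewrite [l \in _]inE => odd_l.
have cardE : #|label_class Z c l| = \sum_b #|label_class Z c l :&: blk b|.
  rewrite -sum1_card (partition_big beta predT) //; apply: eq_bigr => b _.
  rewrite sum1_card; apply: eq_card => x.
  by rewrite !inE unfold_in /= !inE; case: (x \in Z); case: (c x == l).
have /existsP[b odd_b] : [exists b, odd #|label_class Z c l :&: blk b|].
  apply: contraLR odd_l => /existsPn even; rewrite cardE.
  by elim/big_ind: _ => // m n; rewrite oddD => /negbTE-> /negbTE->.
have /card_gt0P[x /setIP[]] : 0 < #|label_class Z c l :&: blk b| by case: #|_| odd_b.
rewrite !inE => /andP[xZ /eqP cx] /andP[_ /eqP bx].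
have blk_c y : y \in blk b -> c y = l.
  by rewrite inE -bx => /andP[yZ /eqP yb]; rewrite -cx; apply: const.
apply/imsetP; exists b.
  rewrite inE -/(blk b); suff <- : label_class Z c l :&: blk b = blk b by [].
  by apply/setIidPr/subsetP=> y yb; rewrite inE blk_c // eqxx; case/setIdP: yb => ->.
rewrite /lab; case: pickP => [y /blk_c /= ->//|/(_ x)].
by rewrite inE xZ bx eqxx.
Qed.

Section DualCertificate.
Variables (G : mgraph) (s : vert G) (v : edge G -> bool -> vert G).
Hypothesis vE : forall e, ends e = [set v e false; v e true].
Notation shalf := (shalf G).
Implicit Types (x y : vert G) (z w : shalf).

Variables (Z : {set shalf}) (c : {ffun shalf -> shalf}).
Notation hv := (hvert v).
Notation Z0 := (negative_at s v).
Hypotheses (Z0Z : Z0 \subset Z) (sepc : separates (hadj v) Z c).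
Hypothesis three : forall u l1 l2, u \in Z -> u \notin Z0 ->
  exists z, [/\ z \notin Z, hadj v u z & c z \notin [:: l1; l2]].

Lemma opp_adj z : hadj v z (opp z).
Proof. by rewrite /hadj eqxx. Qed.

Lemma opposite_sign_adj z w : hv z = hv w -> z.2 != w.2 -> hadj v z w.
Proof. by rewrite /hadj => -> ->; rewrite eqxx orbT. Qed.

(** Spending one excluded label on [c (opp u)] rules out the neighbour across the edge. *)
Lemma removed_neighbour u l : u \in Z -> u \notin Z0 ->
  exists z, [/\ z \notin Z, hv z = hv u, z.2 != u.2 & c z != l].
Proof.
move=> uZ uZ0; have [z [zZ adj]] := three (c (opp u)) l uZ uZ0.
rewrite !inE negb_or => /andP[copp cl]; exists z.
case/orP: adj => [/eqP zE|/andP[/eqP-> uz2]]; first by rewrite zE eqxx in copp.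
by rewrite eq_sym uz2.
Qed.

Lemma removed_off_s u : u \in Z -> u \notin Z0 -> hv u != s.
Proof.
move=> uZ uZ0; have [z [zZ zu z2 _]] := removed_neighbour u uZ uZ0.
apply: contraNneq zZ => us; apply: (subsetP Z0Z).
by move: uZ0 z2; rewrite !inE zu us eqxx; case: (u.2); case: (z.2).
Qed.

(** If [w] remained, all remaining half-edges of the other sign at this vertex would be adjacent to
    it and carry its label, against [removed_neighbour]. *)
Lemma removed_same_sign u w : u \in Z -> u \notin Z0 ->
  hv w = hv u -> w.2 = u.2 -> w \in Z.
Proof.
move=> uZ uZ0 wu w2; apply: contraT => wZ.
have [z [zZ zu z2 /eqP[]]] := removed_neighbour (c w) uZ uZ0.
by apply: sepc => //; apply: opposite_sign_adj; rewrite ?zu ?w2.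
Qed.

Lemma removed_opposite_sign u w : u \in Z -> u \notin Z0 ->
  hv w = hv u -> w.2 != u.2 -> w \notin Z.
Proof.
move=> uZ uZ0 wu w2; apply/negP=> wZ.
have wZ0 : w \notin Z0 by rewrite inE wu (negPf (removed_off_s uZ uZ0)).
have [z [zZ zu z2 _]] := removed_neighbour u uZ uZ0; case/negP: zZ.
apply: (removed_same_sign wZ wZ0); first by rewrite zu wu.
by case: (z.2) (w.2) (u.2) z2 w2 => [] [] [].
Qed.

(** The universal form puts [s] into this side even when no edge meets [s]. *)
Definition dual_A : {set vert G} :=
  [set x | [forall z : shalf, (hv z == x) && z.2 ==> (z \in Z)]].
Definition dual_S : {set vert G} :=
  [set x | (x \in dual_A) || [forall z : shalf, (hv z == x) && ~~ z.2 ==> (z \in Z)]].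
Definition dual_F : {set edge G} := edges_between dual_A (dual_S :\: dual_A).

Notation A := dual_A.
Notation S := dual_S.
Notation F := dual_F.

Lemma s_dual_A : s \in A.
Proof.
rewrite inE; apply/forallP=> z; apply/implyP=> /andP[/eqP zs z2].
by apply: (subsetP Z0Z); rewrite inE zs eqxx.
Qed.

Lemma dual_AS : A \subset S.
Proof. by apply/subsetP=> x; rewrite [x \in S]inE => ->. Qed.

(** Off [Z0], the vertex of a removed half-edge has lost all half-edges of that sign and none of the
    other; those in [Z0] are negative at [s], which lies in [A]. *)
Lemma mem_removed z : (z \in Z) = (hv z \in S) && (z.2 == (hv z \in A)).
Proof.
have signA (g : bool) : hv z \in A -> g -> (z.1, g) \in Z.
  by rewrite inE => /forallP/(_ (z.1, g))/implyP h g1; apply: h; rewrite g1 andbT.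
have signS (g : bool) : hv z \in S -> hv z \notin A -> ~~ g -> (z.1, g) \in Z.
  rewrite [hv z \in S]inE => /orP[->//|/forallP/(_ (z.1, g))/implyP h] _ g0.
  by apply: h; rewrite g0 andbT.
have zE : z = (z.1, z.2) by case: (z).
apply/idP/andP=> [zZ|[zS /eqP z2]]; last first.
  case zA: (hv z \in A) z2 => z2; rewrite zE z2; first exact: signA.
  by apply: signS; rewrite ?zA.
have [zZ0|zZ0] := boolP (z \in Z0).
  move: zZ0; rewrite inE => /andP[/eqP-> ->].
  by rewrite s_dual_A (subsetP dual_AS _ s_dual_A).
have zflip : flip z \notin Z.
  by apply: (removed_opposite_sign zZ zZ0) => //=; case: (z.2).
have allZ : [forall w : shalf, (hv w == hv z) && (w.2 == z.2) ==> (w \in Z)].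
  apply/forallP=> w; apply/implyP=> /andP[/eqP wz /eqP w2].
  exact: removed_same_sign zZ zZ0 wz w2.
have zA : z.2 -> hv z \in A.
  move=> z2; rewrite inE; apply/forallP=> w; apply/implyP=> /andP[wz w2].
  by move/forallP/(_ w): allZ; rewrite wz w2 z2.
have zS : ~~ z.2 -> hv z \in S.
  move=> z2; rewrite inE; apply/orP; right; apply/forallP=> w; apply/implyP=> /andP[wz w2].
  by move/forallP/(_ w): allZ; rewrite wz (negPf w2) (negPf z2).
case z2: z.2 zA zS => zA zS; first by rewrite zA // (subsetP dual_AS) ?zA.
split; first exact: zS.
by rewrite eq_sym eqbF_neg; apply: contra zflip => zA'; rewrite /flip z2 signA.
Qed.

Lemma dual_bipartite : bipartite_subgraph S F.
Proof.
apply/andP; split.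
  apply/subsetP=> e; rewrite (edges_betweenP _ _ (vE e)) [e \in edges_in S]in_set vE !in_setD => h.
  apply/subsetP=> x; rewrite in_set2.
  by case/orP: h => /andP[/(subsetP dual_AS) h1 /andP[_ h2]] /orP[] /eqP->.
by apply/existsP; exists A; rewrite dual_AS /=.
Qed.

Lemma mem_dual_F z : (hedge z \in F) =
  [&& hv z \in S, hv (opp z) \in S & (hv z \in A) != (hv (opp z) \in A)].
Proof.
rewrite (edges_betweenP _ _ (ends_hedge vE z)) !in_setD.
have [AS1 AS2] := (subsetP dual_AS (hv z), subsetP dual_AS (hv (opp z))).
case: (hv z \in A) AS1 => [->//|_];
  case: (hv (opp z) \in A) AS2 => [->//|_]; rewrite ?andbT ?andbF ?orbF //=.
Qed.

Lemma mem_edges_in z : (hedge z \in edges_in S) = (hv z \in S) && (hv (opp z) \in S).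
Proof. by rewrite inE (ends_hedge vE z) subUset !sub1set. Qed.

Definition block_type : finType := (edge G * bool + edge G + {set vert G})%type.

(* Each block is contained in a component of H - Z: an end of an edge of F is a
   block by itself, the two ends of any other edge within S form a block, and so
   do the half-edges in or attached to a component of G - S.  Hence an odd
   component of H - Z contains an odd block. *)
Definition block z : block_type :=
  if hv z \notin S then inr (comp_of S (hv z))
  else if hv (opp z) \notin S then inr (comp_of S (hv (opp z)))
  else if hedge z \in F then inl (inl z.1) else inl (inr (hedge z)).

Lemma same_vertex_label z w : hv z \notin S -> hv w = hv z -> c w = c z.
Proof.
move=> zS wz.
have outZ u : hv u = hv z -> u \notin Z by move=> uz; rewrite mem_removed uz (negPf zS).
have step u u' : hv u = hv z -> hv u' = hv z -> u.2 != u'.2 -> c u = c u'.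
  by move=> uz u'z u2; apply: sepc; rewrite ?outZ //; apply: opposite_sign_adj; rewrite ?uz.
have [eq2|ne2] := eqVneq w.2 z.2; last exact: step.
by rewrite (step w (flip z)) // ?(step (flip z) z) //= ?eq2; case: (z.2).
Qed.

Lemma same_comp_label z w : connect (adj_outside S) (hv z) (hv w) ->
  hv z \notin S -> c z = c w.
Proof.
case/connectP=> p; elim: p z => [|y p IH] z /=; first by move=> _ wz zS; rewrite (same_vertex_label zS wz).
case/andP=> /and3P[xS yS /existsP[e /eqP ee]] py lastw _.
have [u [uz ouy]] : exists u, hv u = hv z /\ hv (opp u) = y.
  move: ee; rewrite vE => /set2_eq[] [<- <-].
    by exists ((e, false), false).
  by exists ((e, true), false).
rewrite -(same_vertex_label xS uz).
have -> : c u = c (opp u).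
  by apply: sepc; rewrite ?opp_adj // mem_removed ?uz ?ouy ?(negPf xS) ?(negPf yS).
by apply: IH; rewrite ouy.
Qed.

Lemma block_comp z C : z \notin Z -> block z = inr C ->
  exists w, [/\ hv w \notin S, comp_of S (hv w) = C & c z = c w].
Proof.
rewrite /block => zZ; case: ifP => [zS [<-]|zS]; first by exists z.
case: ifP => [oS [<-]|_]; last by case: ifP.
exists (opp z); split=> //; apply: sepc => //; last exact: opp_adj.
by rewrite mem_removed (negPf oS).
Qed.

Lemma block_inl z h : block z = inl (inl h) ->
  [/\ hv z \in S, hv (opp z) \in S, hedge z \in F & z.1 = h].
Proof.
rewrite /block; case: ifP => // /negbFE zS; case: ifP => // /negbFE oS.
by case: ifP => // zF [].
Qed.

Lemma block_inr z e : block z = inl (inr e) ->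
  [/\ hv z \in S, hv (opp z) \in S, hedge z \notin F & hedge z = e].
Proof.
rewrite /block; case: ifP => // /negbFE zS; case: ifP => // /negbFE oS.
by case: ifP => // /negbT zF [].
Qed.

Lemma remaining_sign z : hv z \in S -> (z \notin Z) = (z.2 != (hv z \in A)).
Proof. by rewrite mem_removed => ->. Qed.

(** At [S] only one sign of each half-edge remains. An edge within [S] but not in [F] has both ends
    on one side, so its remaining half-edges share a sign and are adjacent. *)
Lemma block_label z w : z \notin Z -> w \notin Z -> block z = block w -> c z = c w.
Proof.
move=> zZ wZ; case bz: (block z) => [[h|e]|C] /esym bw.
- have [zS _ _ zh] := block_inl bz; have [wS _ _ wh] := block_inl bw.
  suff -> : z = w by [].
  have hE : hv z = hv w by rewrite /hvert zh wh.
  move: zZ wZ; rewrite !remaining_sign // hE.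
  rewrite (surjective_pairing z) (surjective_pairing w) zh wh /=.
  by case: z.2; case: w.2; case: (_ \in A).
- have [zS oS zF ze] := block_inr bz; have [wS _ _ we] := block_inr bw.
  have AE : (hv z \in A) = (hv (opp z) \in A).
    by move: zF; rewrite mem_dual_F zS oS => /negbNE/eqP.
  have [wv ww] : (hv w \in A) = (hv z \in A) /\ (w.1 = z.1 \/ w.1 = (opp z).1).
    move: ze we AE; rewrite /hedge /hvert /opp.
    case: (z) (w) => [[e1 b1] g1] [[e2 b2] g2] /= -> ->.
    by case: b1; case: b2 => //= ->; split; auto.
  have gE : w.2 = z.2.
    move: zZ wZ; rewrite !remaining_sign // wv.
    by case: z.2; case: w.2; case: (_ \in A).
  case: ww => w1; have -> : w = (w.1, w.2) by case: (w).
    by rewrite w1 gE; case: (z).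
  rewrite w1 gE; apply: sepc => //; last exact: opp_adj.
  by rewrite remaining_sign // -AE -remaining_sign.
have [z' [z'S z'C ->]] := block_comp zZ bz; have [w' [w'S w'C ->]] := block_comp wZ bw.
by apply: same_comp_label => //; rewrite -comp_of_connect // z'C w'C.
Qed.

(** * Counting half-edges *)

Definition half : finType := (edge G * bool)%type.
Definition half_vert (h : half) : vert G := v h.1 h.2.
Definition half_opp (h : half) : half := (h.1, ~~ h.2).

Lemma card_removed : #|Z| = #|[set h : half | half_vert h \in S]|.
Proof.
pose f (h : half) : shalf := (h, half_vert h \in A).
have f_inj : injective f by move=> h h' [].
rewrite -(card_imset _ f_inj); apply: eq_card => z; rewrite mem_removed.
apply/andP/imsetP=> [[zS /eqP z2]|[h + ->]]; last by rewrite inE /f eqxx.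
by exists z.1; [rewrite inE | rewrite /f -z2; case: (z)].
Qed.

Lemma card_halves_within :
  #|[set h : half | (half_vert h \in S) && (half_vert (half_opp h) \in S)]| =
  (#|edges_in S|).*2.
Proof.
have -> : [set h : half | (half_vert h \in S) && (half_vert (half_opp h) \in S)] =
    setX (edges_in S) [set: bool].
  apply/setP=> -[e b]; rewrite in_setX in_setT andbT inE.
  by rewrite -(mem_edges_in ((e, b), false)).
by rewrite cardsX cardsT card_bool muln2.
Qed.

Definition halves_to (C : {set vert G}) : {set half} :=
  [set h | (half_vert h \in S) && (half_vert (half_opp h) \in C)].

Lemma mem_halves_to C h :
  (h \in halves_to C) = (half_vert h \in S) && (half_vert (half_opp h) \in C).
Proof. exact: in_set. Qed.

Lemma card_halves_to C : C \in comp_minus S -> #|halves_to C| = #|edges_between S C|.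
Proof.
move=> CP; have out x : x \in C -> x \in S = false by move=> /(comp_outside CP)/negbTE.
have inj : {in halves_to C &, injective fst}.
  move=> [e b] [e' b']; rewrite !mem_halves_to /half_vert /half_opp /= => /andP[h1 h2] /andP[h3 h4] ee.
  move: ee h3 h4 => <- h3 h4; congr (_, _); apply/eqP; apply: contraT => bb.
  have bE : ~~ b = b' by case: (b) (b') bb => [] [].
  by have := out _ h2; rewrite bE h3.
rewrite -(card_in_imset inj); apply: eq_card => e.
rewrite (edges_betweenP _ _ (vE e)); apply/imsetP/orP=> [[[e' b]]|].
  rewrite mem_halves_to /half_vert /half_opp /= => /andP[h1 h2] ->.
  by case: b h1 h2 => /= -> ->; [right|left].
case=> /andP[h1 h2].
  by exists (e, false); rewrite // mem_halves_to /half_vert /= h1.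
by exists (e, true); rewrite // mem_halves_to /half_vert /= h1.
Qed.

Lemma card_halves_leaving :
  #|[set h : half | (half_vert h \in S) && (half_vert (half_opp h) \notin S)]| =
  \sum_(C in comp_minus S) #|edges_between S C|.
Proof.
rewrite -sum1_card.
rewrite (partition_big (fun h => comp_of S (half_vert (half_opp h))) (mem (comp_minus S))) /=.
  apply: eq_bigr => C CP; rewrite -card_halves_to // sum1_card; apply: eq_card => h.
  rewrite mem_halves_to unfold_in /= [h \in _]in_set -andbA; congr (_ && _).
  apply/andP/idP=> [[oS /eqP <-]|oC]; first exact: mem_comp_of.
  by rewrite (comp_outside CP oC) (comp_of_eq CP oC).
by move=> h; rewrite inE => /andP[_ /comp_of_in].
Qed.

(** Half-edges at [C] remain with both signs and are paired by [flip]; each half-edge from [S] to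
    [C] remains with one sign. *)
Lemma odd_block_comp C : C \in comp_minus S ->
  odd #|[set z | (z \notin Z) && (block z == inr C)]| = odd #|edges_between S C|.
Proof.
move=> CP; have out x : x \in C -> x \in S = false by move=> /(comp_outside CP)/negbTE.
set X := [set z | _].
rewrite -(cardsID [set z | hv z \in C] X) oddD.
rewrite (@card_involution_half _ (@flip G)) ?odd_double /=; last first.
  move=> z; rewrite !inE /block /= => /andP[_ zC].
  rewrite /hvert /= -/(hv z) in zC *.
  rewrite zC (out _ zC) /= (comp_of_eq CP zC) eqxx !mem_removed /hvert /= -/(hv z).
  rewrite (out _ zC) flipK; split=> //.
  by case: (z) => h []; apply/eqP=> -[].
rewrite -card_halves_to //; congr odd.
pose f (h : half) : shalf := (h, half_vert h \notin A).
have f_inj : injective f by move=> h h' [].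
rewrite -(card_imset _ f_inj); apply: eq_card => z.
apply/idP/imsetP=> [|[h + ->]].
  rewrite !inE /block => /and3P[zC zZ].
  case: ifP => [zS /eqP[zCE]|/negbFE zS]; first by rewrite -zCE mem_comp_of in zC.
  case: ifP => [oS /eqP[oCE]|_]; last by case: ifP.
  exists z.1; first by rewrite mem_halves_to /half_vert zS -oCE mem_comp_of.
  move: zZ; rewrite remaining_sign // /f /half_vert -/(hv z).
  by case: z {zC zS oS oCE} => h g /=; case: g; case: (_ \in A).
rewrite mem_halves_to => /andP[hS oC]; rewrite !inE /block.
have -> : hv (f h) = half_vert h by [].
have -> : hv (opp (f h)) = half_vert (half_opp h) by [].
rewrite hS (out _ oC) /= (comp_of_eq CP oC) eqxx andbT remaining_sign //=.
rewrite -/(half_vert h); case hC: (half_vert h \in C); first by rewrite (out _ hC) in hS.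
by case: (_ \in A).
Qed.

(** The blocks of edges within [S] outside [F] are even, being paired by [opp]. Odd blocks thus come
    from the half-edges of [F] or from components. *)
Lemma card_odd_labels :
  #|odd_labels Z c| <= (#|F|).*2 + #|[set C in comp_minus S | odd #|edges_between S C|]|.
Proof.
apply: leq_trans (odd_labels_refine block_label) _.
pose D := setX F [set: bool]; set K := [set C in _ | _].
have -> : (#|F|).*2 = #|D| by rewrite cardsX cardsT card_bool muln2.
pose i1 (h : half) : block_type := inl (inl h); pose i2 C : block_type := inr C.
have i1_inj : injective i1 by move=> h h' [].
have i2_inj : injective i2 by move=> C C' [].
rewrite -(card_imset _ i1_inj) -(card_imset _ i2_inj).
apply: leq_trans (leq_card_setU _ _); apply/subset_leq_card/subsetP=> b.
rewrite inE => odd_b; rewrite in_setU.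
have /card_gt0P[z] : 0 < #|[set z | (z \notin Z) && (block z == b)]| by case: #|_| odd_b.
rewrite inE => /andP[zZ /eqP zb]; case: b zb odd_b => [[h|e]|C] zb odd_b.
- have [_ _ zF zh] := block_inl zb; apply/orP; left; apply: imset_f.
  by case: (h) zh => e b zh; rewrite in_setX in_setT /= andbT -[e]/((e, b).1) -zh.
- case/negP: odd_b; rewrite (@card_involution_half _ (@opp G)) ?odd_double //= => w.
  rewrite !inE => /andP[wZ /eqP we]; have [wS oS wF ew] := block_inr we.
  have AE : (hv w \in A) = (hv (opp w) \in A).
    by move: wF; rewrite mem_dual_F wS oS => /negbNE/eqP.
  have -> : opp w \notin Z by rewrite remaining_sign // -AE -remaining_sign.
  rewrite oppK /block oppK oS wS /= -[hedge (opp w)]/(hedge w) (negPf wF) ew eqxx.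
  by split=> //; case: (w) => [[e' []] g]; apply/eqP=> -[].
apply/orP; right; apply: imset_f.
have CP : C \in comp_minus S.
  move: zb; rewrite /block; case: ifP => [zS [<-]|_]; first exact: comp_of_in.
  by case: ifP => [oS [<-]|_]; [exact: comp_of_in | case: ifP].
by rewrite inE CP -odd_block_comp.
Qed.

(** Each half-edge at [S] loses exactly one sign, so [#|Z|] is twice |E(S)| plus the sum of the
    |E(S,C)|. Subtracting the bound on odd labels leaves 2|E(S) \ F| and twice the rounded
    halves. *)
Lemma dual_bound : (bound S F).*2 + #|odd_labels Z c| <= #|Z|.
Proof.
apply: leq_trans (leq_add (leqnn _) card_odd_labels) _.
rewrite card_removed -(cardsID [set h : half | half_vert (half_opp h) \in S]).
have -> : [set h : half | half_vert h \in S] :&: [set h : half | half_vert (half_opp h) \in S] =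
    [set h : half | (half_vert h \in S) && (half_vert (half_opp h) \in S)].
  by apply/setP=> h; rewrite !inE.
have -> : [set h : half | half_vert h \in S] :\: [set h : half | half_vert (half_opp h) \in S] =
    [set h : half | (half_vert h \in S) && (half_vert (half_opp h) \notin S)].
  by apply/setP=> h; rewrite [LHS]in_setD !in_set andbC.
rewrite card_halves_within card_halves_leaving.
have -> : \sum_(C in comp_minus S) #|edges_between S C| =
    #|[set C in comp_minus S | odd #|edges_between S C|]| +
    (\sum_(C in comp_minus S) #|edges_between S C| %/ 2).*2.
  have -> : #|[set C in comp_minus S | odd #|edges_between S C|]| =
      \sum_(C in comp_minus S) odd #|edges_between S C|.
    rewrite -sum1_card (eq_bigl (fun C => (C \in comp_minus S) && odd #|edges_between S C|)).
      by rewrite big_mkcondr; apply: eq_bigr => C _; case: (odd _).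
    by move=> C; rewrite inE.
  rewrite -muln2 big_distrl /= -big_split; apply: eq_bigr => C _ /=.
  by rewrite {1}(divn_eq #|edges_between S C| 2) modn2 addnC.
have FE : F \subset edges_in S by case/andP: dual_bipartite.
have := cardsID F (edges_in S); rewrite (setIidPr FE) /bound.
by move: #|edges_in S :\: F| #|F| #|edges_in S| (\sum_(C in _) _) #|_| => a b e t k; lia.
Qed.
End DualCertificate.

Lemma edge_ends_exist (G : mgraph) :
  exists v : edge G -> bool -> vert G, forall e, ends e = [set v e false; v e true].
Proof.
have : forall e : edge G, exists p : vert G * vert G, ends e = [set p.1; p.2].
  move=> e; have := ends_card e.
  case cE: #|ends e| => [|[|[|]]] // _.
    by move: cE => /eqP/cards1P[x ->]; exists (x, x); rewrite /= setUid.
  by move: cE => /eqP/cards2P[x [y [_ ->]]]; exists (x, y).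
case/fin_all_exists=> f fE.
by exists (fun e b => if b then (f e).2 else (f e).1).
Qed.

Theorem theorem6p1 (G : mgraph) (s : vert G) :
  (exists (S : {set vert G}) (F : {set edge G}),
     [/\ s \in S, bipartite_subgraph S F & nu s s = bound S F]) /\
  (forall (S : {set vert G}) (F : {set edge G}),
     s \in S -> bipartite_subgraph S F -> nu s s <= bound S F).
Proof.
have weak (S : {set vert G}) (F : {set edge G}) : s \in S -> bipartite_subgraph S F -> nu s s <= bound S F.
  by move=> sS /andP[_ /existsP[A /andP[_ FA]]]; exact: nu_le_bound sS FA.
split=> //; have [v vE] := edge_ends_exist G.
have [m [Z [c [mm Z0Z sepc lec three]]]] :=
  tutte_berge_minimal (@hadj_sym G v) (negative_at s v).
have sS := subsetP (dual_AS v Z) _ (s_dual_A Z0Z).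
have bip := dual_bipartite vE Z.
exists (dual_S v Z), (dual_F v Z); split=> //.
apply/eqP; rewrite eqn_leq weak //= -leq_double.
(* With Z0 the negative half-edges at [s], the chain is: twice the bound <= [#|Z|] - odd labels <=
   [#|Z0|] - missed <= twice nu. The last step uses that [flip] matches [starts] with Z0. *)
have dual := dual_bound vE Z0Z sepc three.
have primal := card_starts vE mm.
have eq_starts : #|starts s v| = #|negative_at s v|.
  rewrite -(card_imset _ (inv_inj (@flipK G))); apply: eq_card => z.
  apply/imsetP/idP=> [[w + ->]|]; rewrite !inE /= => zs; first exact: zs.
  by exists (flip z); rewrite ?flipK // inE /= negbK.
have := cardsID (negative_at s v) Z; rewrite (setIidPr Z0Z).
lia.
Qed.
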